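(* For any finite simple graph $G$, $$\ell(\mathcal A(G))=\min_{\vec G}\ \sum_{v\in V(G)} d^+_{\vec G}(v)\,d^-_{\vec G}(v),$$ where the minimum is taken over all orientations $\vec G$ of $G$.
   Context: For an orientation $\vec G$ of $G$, $d^+_{\vec G}(v)$ and $d^-_{\vec G}(v)$ are the numbers of edges leaving and entering $v$. Fix an orientation of the edges of $G=(V,E)$; the oriented incidence matrix $D$ is the $|V|\times|E|$ matrix with $D_{ve}=+1$ if $v$ is the head of $e$, $-1$ if $v$ is the tail of $e$, and $0$ otherwise. The antisymmetric line graph $\mathcal A(G)$ is the signed graph with vertex set $E(G)$ and signed adjacency matrix $D^{\mathsf T}D-2I$ (nonzero entries are edges, with the entry $\pm1$ as sign). Switching a signed graph at a vertex reverses the signs of all edges incident to it; changing the orientation changes $\mathcal A(G)$ only by switching. The sign of a cycle is the product of its edge signs, and a signed graph is balanced if all its cycles are positive. The frustration index $\ell(\Sigma)$ of a signed graph $\Sigma$ is the minimum number of edges whose deletion makes $\Sigma$ balanced (equivalently, the minimum number of negative edges among all switchings of $\Sigma$); it is switching invariant. *)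

(* Defs.v *)
From HB Require Import structures.
From mathcomp Require Import all_boot all_order all_algebra.

Set Implicit Arguments.
Unset Strict Implicit.
Unset Printing Implicit Defensive.

Import GRing.Theory.

Record simple_graph := SimpleGraph {
  vertex :> finType;
  adj : rel vertex;
  adj_sym : symmetric adj;
  adj_irr : irreflexive adj
}.

Definition edges (G : simple_graph) : {set {set G}} :=
  [set [set p.1; p.2] | p : G * G & adj p.1 p.2].

Definition edge (G : simple_graph) : finType := {e : {set G} | e \in edges G}.

Lemma edge_card (G : simple_graph) (e : edge G) : #|val e| = 2.
Proof.
case: e => e /= /imsetP[[u v]]; rewrite inE /= => uv ->.
rewrite cards2; case: eqP => // uv_eq.
by move: uv; rewrite uv_eq adj_irr.
Qed.

(* An orientation picks the head of every edge; the tail is the other end. *)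
Definition orientation (G : simple_graph) : finType :=
  {h : {ffun edge G -> G} | [forall e, h e \in val e]}.

Section Orientation.
Variables (G : simple_graph) (O : orientation G).

Definition is_head (v : G) (e : edge G) : bool := v == val O e.
Definition is_tail (v : G) (e : edge G) : bool :=
  (v \in val e) && (v != val O e).

Definition outdeg (v : G) : nat := #|[set e | is_tail v e]|.
Definition indeg (v : G) : nat := #|[set e | is_head v e]|.

Local Open Scope ring_scope.

Definition incidence (v : G) (e : edge G) : int :=
  if is_head v e then 1 else if is_tail v e then -1 else 0.

Definition incidence_mx : 'M[int]_(#|G|, #|edge G|) :=
  \matrix_(i, j) incidence (enum_val i) (enum_val j).

Definition line_adj (e f : edge G) : int :=
  (incidence_mx^T *m incidence_mx - 2%:M) (enum_rank e) (enum_rank f).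

Lemma line_adjE (e f : edge G) :
  line_adj e f = \sum_(v : G) incidence v e * incidence v f - 2 *+ (e == f).
Proof.
rewrite /line_adj !mxE (inj_eq enum_rank_inj); congr (_ - _).
rewrite [RHS](reindex (@enum_val _ (mem G))) /=.
  by apply: eq_bigr => i _; rewrite !mxE !enum_rankK.
by exists enum_rank => i _; rewrite ?enum_valK ?enum_rankK.
Qed.

Lemma head_in (e : edge G) : val O e \in val e.
Proof. exact: (forallP (valP O)). Qed.

Lemma incidence_out (v : G) (e : edge G) : v \notin val e -> incidence v e = 0.
Proof.
rewrite /incidence /is_head /is_tail => /negPf ve; rewrite ve /=.
by case: eqP => // v_hd; move: ve; rewrite v_hd head_in.
Qed.

Lemma incidence_in (v : G) (e : edge G) :
  v \in val e -> incidence v e = 1 \/ incidence v e = -1.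
Proof.
rewrite /incidence /is_head /is_tail => ->.
by case: eqP => _ /=; [left | right].
Qed.

Lemma line_adj_sym (e f : edge G) : line_adj e f = line_adj f e.
Proof.
rewrite !line_adjE eq_sym; congr (_ - _).
by apply: eq_bigr => v _; rewrite mulrC.
Qed.

Lemma line_adj_diag (e : edge G) : line_adj e e = 0.
Proof.
rewrite line_adjE eqxx (bigID (mem (val e))) /=.
rewrite [X in _ + X - _]big1; last first.
  by move=> v ve; rewrite incidence_out // mul0r.
rewrite (eq_bigr (fun=> 1)) => [|v /incidence_in[]-> //].
by rewrite sumr_const edge_card.
Qed.

Lemma line_adj_vals (e f : edge G) : line_adj e f \in [:: 0; 1; -1].
Proof.
case: (eqVneq e f) => [->|ef]; first by rewrite line_adj_diag.
rewrite line_adjE (negPf ef) subr0.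
have [/existsP[v /andP[ve vf]]|none] :=
  boolP [exists v, (v \in val e) && (v \in val f)].
  rewrite (bigD1 v) //= big1 ?addr0 => [|w wv].
    by case: (incidence_in ve) => ->; case: (incidence_in vf) => ->.
  case: (boolP (w \in val e)) => [we|/incidence_out->]; last by rewrite mul0r.
  case: (boolP (w \in val f)) => [wf|/incidence_out->]; last by rewrite mulr0.
  have pair (g : edge G) : v \in val g -> w \in val g -> [set v; w] = val g.
    move=> vg wg; apply/eqP; rewrite eqEcard edge_card cards2 eq_sym wv andbT.
    by apply/subsetP=> x; rewrite !inE => /orP[]/eqP->.
  by case/eqP: ef; apply: val_inj; rewrite -(pair e) // -(pair f).
rewrite big1 // => v _.
case: (boolP (v \in val e)) => [ve|/incidence_out->]; last by rewrite mul0r.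
case: (boolP (v \in val f)) => [vf|/incidence_out->]; last by rewrite mulr0.
by case/existsP: none; exists v; rewrite ve vf.
Qed.

End Orientation.

Lemma orientation_exists (G : simple_graph) : exists O : orientation G, true.
Proof.
have nonempty (e : edge G) : exists v, v \in val e.
  by apply/card_gt0P; rewrite edge_card.
have hP : [forall e : edge G, [ffun e => xchoose (nonempty e)] e \in val e].
  by apply/forallP=> e; rewrite ffunE; apply: xchooseP.
by exists (exist (fun h : {ffun edge G -> G} => [forall e, h e \in val e]) _ hP).
Qed.

Record signed_graph := SignedGraph {
  svertex :> finType;
  sadj : svertex -> svertex -> int;
  sadj_sym : forall u v, sadj u v = sadj v u;
  sadj_diag : forall u, sadj u u = 0%R;
  sadj_vals : forall u v, sadj u v \in [:: 0; 1; -1]%R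
}.

Section SignedGraph.
Variable S : signed_graph.

Definition srel : rel S := fun u v => sadj u v != 0%R.

Lemma srel_sym : symmetric srel.
Proof. by move=> u v; rewrite /srel sadj_sym. Qed.

Lemma srel_irr : irreflexive srel.
Proof. by move=> u; rewrite /srel sadj_diag eqxx. Qed.

Definition underlying : simple_graph := SimpleGraph srel_sym srel_irr.

Definition is_cycle (c : seq S) : bool :=
  (2 < size c) && ucycleb srel c.

Definition cycle_sign (c : seq S) : int := (\prod_(u <- c) sadj u (next c u))%R.

(* The cycles are enumerated by length so that balance is decidable; the bound
   #|S| on the length is no restriction, see balancedP. *)
Definition balanced : bool :=
  [forall n : 'I_#|S|.+1, forall c : n.-tuple S,
     is_cycle c ==> (cycle_sign c == 1%R)].

Lemma balancedP :
  reflect (forall c : seq S, is_cycle c -> cycle_sign c = 1%R) balanced.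
Proof.
apply: (iffP forallP) => [bal c cyc|bal n]; last first.
  by apply/forallP=> c; apply/implyP=> /bal->.
have szc : size c < #|S|.+1.
  by case/and3P: cyc => _ _ uc; rewrite ltnS -(card_uniqP uc) max_card.
have /forallP/(_ (in_tuple c)) := bal (Ordinal szc).
by move=> /implyP/(_ cyc)/eqP.
Qed.

Section Delete.
Variable F : {set {set S}}.

Definition delete_adj (u v : S) : int :=
  if [set u; v] \in F then 0%R else sadj u v.

Lemma delete_adj_sym u v : delete_adj u v = delete_adj v u.
Proof. by rewrite /delete_adj setUC sadj_sym. Qed.

Lemma delete_adj_diag u : delete_adj u u = 0%R.
Proof. by rewrite /delete_adj sadj_diag if_same. Qed.

Lemma delete_adj_vals u v : delete_adj u v \in [:: 0; 1; -1]%R.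
Proof. by rewrite /delete_adj; case: ifP => // _; apply: sadj_vals. Qed.

Definition delete_edges : signed_graph :=
  SignedGraph delete_adj_sym delete_adj_diag delete_adj_vals.

End Delete.

End SignedGraph.

(* The initial value of the minimum is attained, see balanced_delete_all. *)
Definition frustration_index (S : signed_graph) : nat :=
  \big[minn/#|edges (underlying S)|]_(F : {set {set S}} |
      (F \subset edges (underlying S)) && balanced (delete_edges F)) #|F|.

Lemma balanced_delete_all (S : signed_graph) :
  balanced (@delete_edges S (edges (underlying S))).
Proof.
apply/balancedP=> -[|u [|v c]] // /and3P[_ /andP[+ _] _].
rewrite /srel /= /delete_adj; case: ifP; rewrite ?eqxx // => /negbT + uv.
by case/negP; apply/imsetP; exists (u, v); rewrite ?inE.
Qed.

(* The antisymmetric line graph computed from the reference orientation O. *)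
Definition antisym_line_graph (G : simple_graph) (O : orientation G) :
    signed_graph :=
  SignedGraph (line_adj_sym O) (line_adj_diag O) (line_adj_vals O).

(* Main.v *)
(** Reversing the edges where a sign function [s] is [-1] switches the
    antisymmetric line graph by [s], and the negative edges of the line graph
    of [O] are the pairs (edge into [v], edge out of [v]), each pair having a
    unique such [v]; so their number is the sum of [outdeg * indeg].  Every
    switching arises from an orientation, and by Harary's theorem the balanced
    deletions are those containing the negative edges of some switching. *)
Require Import Defs.
From mathcomp Require Import all_boot all_order all_algebra zify.

Set Implicit Arguments.
Unset Strict Implicit.
Unset Printing Implicit Defensive.

Import GRing.Theory.

(** * Bounds for minima over finite types, and a splitting of lists *)

Lemma bigminn_le_cond (I : finType) (P : pred I) (F : I -> nat) x i :
  P i -> \big[minn/x]_(j | P j) F j <= F i.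
Proof.
move=> Pi; have := mem_index_enum i; elim: (index_enum I) => // j r IHr.
rewrite inE big_cons => /predU1P[<-|/IHr le_i]; first by rewrite Pi geq_minl.
by case: ifP => // _; rewrite geq_min le_i orbT.
Qed.

Lemma leq_bigminn (I : finType) (P : pred I) (F : I -> nat) x m :
  m <= x -> (forall i, P i -> m <= F i) -> m <= \big[minn/x]_(i | P i) F i.
Proof. by move=> le_x le_F; elim/big_ind: _ => // a b; rewrite leq_min => ->. Qed.

(** Serves to cut a closed walk at a repeated vertex. *)
Lemma not_uniq_split (T : eqType) (s : seq T) : ~~ uniq s ->
  exists y p1 p2 p3, s = p1 ++ y :: p2 ++ y :: p3.
Proof.
elim: s => //= x s IHs; rewrite negb_and negbK.
have [/splitPr[p2 p3] _|_ /IHs[y [p1 [p2 [p3 ->]]]]] := boolP (x \in s).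
  by exists x, [::], p2, p3.
by exists y, (x :: p1), p2, p3.
Qed.

(** * Signs of closed walks and Harary's balance theorem *)

Section Balance.
Local Open Scope ring_scope.
Variable S : signed_graph.
Implicit Types (x y u v : S) (p : seq S).

Fixpoint walk_sign x p : int :=
  if p is y :: p' then sadj x y * walk_sign y p' else 1.

Lemma walk_sign_cat x p1 p2 :
  walk_sign x (p1 ++ p2) = walk_sign x p1 * walk_sign (last x p1) p2.
Proof. by elim: p1 x => [|y p1 IH] x /=; rewrite ?mul1r // IH mulrA. Qed.

Lemma cycle_sign_walk x p :
  uniq (x :: p) -> cycle_sign (x :: p) = walk_sign x (rcons p x).
Proof.
(* The closing vertex [x0] is kept apart from the start [y], so that the induction can advance the
   start alone. *)
suff nextE x0 y q : uniq (y :: q) ->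
    \prod_(u <- y :: q) sadj u (next_at u x0 y q) = walk_sign y (rcons q x0).
  exact: nextE.
elim: q y => [|z q IH] y; first by rewrite big_seq1 /= eqxx mulr1.
case/andP=> y_zq /IH /= <-; rewrite big_cons eqxx; congr (_ * _).
rewrite big_seq [RHS]big_seq; apply: eq_bigr => u u_zq.
by case: eqP => // uy; rewrite -uy u_zq in y_zq.
Qed.

Lemma sadj_sqr u v : srel u v -> sadj u v * sadj u v = 1.
Proof. by rewrite /srel; have := sadj_vals u v; rewrite !inE => /or3P[]/eqP->. Qed.

Lemma walk_sign_sqr x p : path (@srel S) x p -> walk_sign x p * walk_sign x p = 1.
Proof.
elim: p x => //= y p IH x /andP[/sadj_sqr xy /IH py].
by rewrite mulrACA xy py.
Qed.

(** Such an [s] takes values 1 and -1, and switching by it makes every edge positive. *)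
Definition potential (s : S -> int) :=
  (forall u, s u * s u = 1) /\ (forall u v, srel u v -> sadj u v = s u * s v).

(** Along a walk the inner values of [s] cancel in pairs; on a closed walk the two outer ones cancel
    as well. *)
Lemma potential_balanced s : potential s -> balanced S.
Proof.
case=> s2 sE; apply/balancedP=> -[|x p] // /and3P[_ cyc uniq_xp].
rewrite cycle_sign_walk //.
suff walkE y q : path (@srel S) y q -> walk_sign y q = s y * s (last y q).
  by rewrite walkE // last_rcons.
elim: q y => [|z q IH] y /=; first by rewrite s2.
by case/andP=> /sE-> /IH->; rewrite mulrA -[_ * s z * s z]mulrA s2 mulr1.
Qed.

(** Induction on length: a closed walk without repetition is empty, a step back and forth, or a
    cycle; any other one contains a shorter closed walk that can be cut out. *)
Lemma balanced_closed_walk x p :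
  balanced S -> path (@srel S) x p -> last x p = x -> walk_sign x p = 1.
Proof.
move=> /balancedP bal; have [n] := ubnP (size p).
elim: n x p => // n IHn x p lt_pn walk_p.
have [uniq_p last_p|/not_uniq_split[y [p1 [p2 [p3 Dp]]]]] := boolP (uniq p).
  case/lastP: p lt_pn walk_p uniq_p last_p => // p z _ walk_p uniq_p.
  rewrite last_rcons => zx; rewrite {z}zx in walk_p uniq_p *.
  have uniq_xp : uniq (x :: p) by rewrite /= -rcons_uniq.
  case: p walk_p {uniq_p} uniq_xp => [|y [|z p]] walk_p uniq_xp.
  - by move: walk_p; rewrite /= srel_irr.
  - case/andP: walk_p => xy _; rewrite /= mulr1 [sadj y x]sadj_sym.
    exact: sadj_sqr.
  - by rewrite -cycle_sign_walk //; apply/bal/and3P; split.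
(* Regroup as a walk to [y], a closed walk at [y], and the rest, so that both the middle and the
   walk without it are shorter. *)
rewrite {p}Dp -cat_rcons in lt_pn walk_p *.
rewrite -cat_rcons catA in lt_pn walk_p *.
move: lt_pn walk_p; rewrite !size_cat !size_rcons !cat_path !last_cat !last_rcons.
move=> lt_n /andP[/andP[walk1 walk2] walk3] last_p.
have sign2 : walk_sign y (rcons p2 y) = 1.
  by apply: IHn; rewrite ?last_rcons // size_rcons; lia.
rewrite !walk_sign_cat !last_cat !last_rcons sign2 mulr1.
have := IHn x (rcons p1 y ++ p3).
rewrite walk_sign_cat cat_path last_cat !last_rcons walk1 walk3; apply=> //.
by rewrite size_cat size_rcons; lia.
Qed.

(* Harary's theorem: the potential of [u] is the sign of a walk from [u] to the
   root of its component. *)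
Lemma balanced_potential : balanced S -> exists s, potential s.
Proof.
move=> bal; have symS := sym_connect_sym (@srel_sym S).
have exP u : exists p, path (@srel S) u p /\ fingraph.root (@srel S) u = last u p.
  by have /connectP[p up ->] := connect_root (@srel S) u; exists p.
have [P PP] := fin_all_exists exP.
exists (fun u => walk_sign u (P u)); split=> [u|u v uv].
  by case: (PP u) => /walk_sign_sqr.
have [[walk_u last_u] [walk_v last_v]] := (PP u, PP v).
have root_uv : fingraph.root (@srel S) u = fingraph.root (@srel S) v.
  by apply/(fingraph.rootP symS)/connect1.
have /connectP[q walk_q last_q] : connect (@srel S) (fingraph.root (@srel S) u) u.
  by rewrite symS connect_root.
(* Closing both walks from [u] to the root by the same return walk [q] shows
   that they have the same sign. *)
have signu : walk_sign u (P u) * walk_sign (fingraph.root (@srel S) u) q = 1.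
  rewrite last_u -walk_sign_cat balanced_closed_walk //.
    by rewrite cat_path walk_u -last_u.
  by rewrite last_cat -last_u.
have signv : sadj u v * walk_sign v (P v) *
    walk_sign (fingraph.root (@srel S) u) q = 1.
  rewrite root_uv last_v -mulrA -walk_sign_cat.
  rewrite -[_ * _]/(walk_sign u (v :: P v ++ q)) balanced_closed_walk //=.
    by rewrite uv cat_path walk_v -last_v -root_uv.
  by rewrite last_cat -last_v -root_uv.
have q2 := walk_sign_sqr walk_q.
have -> : walk_sign u (P u) = sadj u v * walk_sign v (P v).
  by rewrite -[LHS]mulr1 -[RHS]mulr1 -q2 !mulrA signu signv.
by rewrite -mulrA walk_sign_sqr ?mulr1.
Qed.

End Balance.

(** * Reorientation of edges as switching of the line graph *)

Section Switching.
Local Open Scope ring_scope.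
Variable G : simple_graph.
Implicit Types (O : orientation G) (v w : G) (e f : edge G).

Lemma edge_pair e v w : v \in val e -> w \in val e -> v != w ->
  val e = [set v; w].
Proof.
move=> ve we vw; apply/esym/eqP; rewrite eqEcard edge_card cards2 vw andbT.
by apply/subsetP=> x; rewrite !inE => /orP[]/eqP->.
Qed.

(** Two distinct vertices determine the edge joining them. *)
Lemma common_vertex_inj e f v w : e != f ->
  v \in val e -> v \in val f -> w \in val e -> w \in val f -> v = w.
Proof.
move=> ef ve vf we wf; apply/eqP/negPn/negP=> vw; case/eqP: ef.
by apply: val_inj; rewrite (edge_pair ve we vw) (edge_pair vf wf vw).
Qed.

Definition switched O O' (s : edge G -> int) :=
  forall v e, incidence O v e = s e * incidence O' v e.

(** The entries of the Gram matrix scale by [s e * s f]; on the diagonal both sides vanish. *)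
Lemma line_adj_switched O O' s e f : switched O O' s ->
  line_adj O e f = s e * s f * line_adj O' e f.
Proof.
move=> sO; have [<-|ef] := eqVneq e f; first by rewrite !line_adj_diag mulr0.
rewrite !line_adjE (negPf ef) !subr0 mulr_sumr.
by apply: eq_bigr => v _; rewrite !sO mulrACA.
Qed.

Definition reversal_sign O O' e : int := if val O e == val O' e then 1 else -1.

Lemma reversal_sign_sqr O O' e : reversal_sign O O' e * reversal_sign O O' e = 1.
Proof. by rewrite /reversal_sign; case: ifP. Qed.

(** Where the heads differ, the head in one orientation is the tail in the other. *)
Lemma switched_reversal O O' : switched O O' (reversal_sign O O').
Proof.
move=> v e; rewrite /reversal_sign.
have [ve|ve] := boolP (v \in val e); last by rewrite !incidence_out ?mulr0.
rewrite /incidence /is_head /is_tail ve.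
have [->|OO'] := eqVneq (val O e) (val O' e); first by rewrite mul1r.
have := ve; rewrite (edge_pair (head_in O e) (head_in O' e) OO') !inE.
by case/orP=> /eqP->; rewrite eqxx ?(negPf OO') // eq_sym (negPf OO').
Qed.

(** Keep the head where [s] is 1 and take the other end elsewhere; then [s] is the reversal sign. *)
Lemma reorientation O' (s : edge G -> int) : (forall e, s e * s e = 1) ->
  exists O, switched O O' s.
Proof.
move=> s2.
have exh e : exists h, h \in val e /\ (h == val O' e) = (s e == 1).
  case: (eqVneq (s e) 1) => _; first by exists (val O' e); rewrite head_in eqxx.
  have : (0 < #|val e :\ val O' e|)%N.
    have := cardsD1 (val O' e) (val e).
    by rewrite edge_card head_in add1n => -[<-].
  by case/card_gt0P=> h; rewrite !inE => /andP[/negPf hO' he]; exists h.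
have [h hP] := fin_all_exists exh.
have hO : [forall e, finfun h e \in val e].
  by apply/forallP=> e; rewrite ffunE; case: (hP e).
pose O : orientation G :=
  exist (fun h : {ffun edge G -> G} => [forall e, h e \in val e]) (finfun h) hO.
exists O => v e; rewrite (switched_reversal O O'); congr (_ * _).
rewrite /reversal_sign /= ffunE; case: (hP e) => _ ->.
have /eqP := s2 e; rewrite -expr2 sqrf_eq1.
by case: eqP => [->|_ /eqP].
Qed.

(** * Counting the negative edges of the line graph *)

Definition negative_edges O : {set {set edge G}} :=
  [set [set p.1; p.2] | p : edge G * edge G & line_adj O p.1 p.2 == -1].

Lemma negative_edgesP O e f :
  reflect (line_adj O e f = -1) ([set e; f] \in negative_edges O).
Proof.
apply: (iffP imsetP) => [[[e' f']]|ef]; last by exists (e, f); rewrite ?inE ?ef.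
rewrite inE /= => /eqP ef' Def; have : e' \in [set e; f] by rewrite Def set21.
have : f' \in [set e; f] by rewrite Def set22.
rewrite !inE => /orP[] /eqP Df /orP[] /eqP De; move: ef';
  by rewrite De Df ?line_adj_diag // line_adj_sym.
Qed.

Lemma line_adj_common O e f v : e != f -> v \in val e -> v \in val f ->
  line_adj O e f = incidence O v e * incidence O v f.
Proof.
move=> ef ve vf; rewrite line_adjE (negPf ef) subr0 (bigD1 v) //= big1 ?addr0 //.
move=> w wv; have [we|] := boolP (w \in val e); last first.
  by move/(incidence_out O)->; rewrite mul0r.
have [wf|] := boolP (w \in val f); last first.
  by move/(incidence_out O)->; rewrite mulr0.
by rewrite (common_vertex_inj ef we wf ve vf) eqxx in wv.
Qed.

Lemma line_adj_disjoint O e f : e != f ->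
  (forall v, v \in val e -> v \notin val f) -> line_adj O e f = 0.
Proof.
move=> ef dis; rewrite line_adjE (negPf ef) subr0 big1 // => v _.
have [/dis|] := boolP (v \in val e); move/(incidence_out O)->; last exact: mul0r.
exact: mulr0.
Qed.

Lemma card_negative_edges O :
  #|negative_edges O| = (\sum_(v : G) outdeg O v * indeg O v)%N.
Proof.
(* The triples (vertex, edge leaving it, edge entering it) give the degree sum when grouped by
   vertex, and forgetting the vertex and the order maps them bijectively onto the negative edges. *)
pose T := [set t : G * (edge G * edge G) |
  is_tail O t.1 t.2.1 && is_head O t.1 t.2.2].
have tailP v e : is_tail O v e -> v \in val e by case/andP.
have headP v e : is_head O v e -> v \in val e by move/eqP->; apply: head_in.
have head_tail v e : is_head O v e -> is_tail O v e -> False.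
  by rewrite /is_tail => /eqP->; rewrite eqxx andbF.
have Tneq v e f : is_tail O v e -> is_head O v f -> e != f.
  by move=> te hf; apply/eqP=> ef; apply: (head_tail v f) => //; rewrite -ef.
have inc_tail v e : is_tail O v e -> incidence O v e = -1.
  by rewrite /incidence; case: ifP => [/head_tail hv /hv//|_ ->].
have inc_head v e : is_head O v e -> incidence O v e = 1.
  by rewrite /incidence => ->.
have -> : (\sum_(v : G) outdeg O v * indeg O v = #|T|)%N.
  rewrite -sum1_card (eq_bigl (fun t => xpredT t.1 && (t.2 \in
    setX [set e | is_tail O t.1 e] [set e | is_head O t.1 e]))); last first.
    by case=> v [e f]; rewrite !inE.
  rewrite -(pair_big_dep xpredT (fun v p => p \in
    setX [set e | is_tail O v e] [set e | is_head O v e]) (fun _ _ => 1%N)) /=.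
  by apply: eq_bigr => v _; rewrite sum1_card cardsX.
have <- : [set [set t.2.1; t.2.2] | t in T] = negative_edges O.
  apply/setP=> A; apply/imsetP/imsetP=> [[[v [e f]]]|[[e f]]]; rewrite inE /=.
    case/andP=> te hf ->; exists (e, f) => //; rewrite inE /=.
    rewrite (line_adj_common O (Tneq v e f te hf) (tailP _ _ te) (headP _ _ hf)).
    by rewrite inc_tail // inc_head.
  have [->|ef] := eqVneq e f; first by rewrite line_adj_diag.
  move=> /eqP adj_ef ->.
  have [v /andP[ve vf]|none] := pickP (fun v => (v \in val e) && (v \in val f)).
    move: adj_ef; rewrite (line_adj_common O ef ve vf).
    (* The product of incidences at the common vertex is -1 only if one edge enters and the other
       leaves. *)
    have [he|he] := boolP (is_head O v e); have [hf|hf] := boolP (is_head O v f).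
    - by rewrite !inc_head.
    - by exists (v, (f, e)); rewrite /= 1?setUC // inE /= he andbT /is_tail vf.
    - by exists (v, (e, f)); rewrite //= inE /= hf andbT /is_tail ve.
    - by rewrite !inc_tail // /is_tail ?vf ?ve.
  rewrite line_adj_disjoint // in adj_ef.
  by move=> v ve; have := none v; rewrite ve /= => ->.
apply: card_in_imset => -[v [e f]] [w [e' f']]; rewrite !inE /=.
move=> /andP[te hf] /andP[te' hf'] Def.
have nef := Tneq _ _ _ te hf; have nef' := Tneq _ _ _ te' hf'.
have : e' \in [set e; f] by rewrite Def set21.
have : f' \in [set e; f] by rewrite Def set22.
have [ve vf] := (tailP _ _ te, headP _ _ hf).
have [we' wf'] := (tailP _ _ te', headP _ _ hf').
(* If the two pairs agree in order, the common vertex is the same; if they are swapped, [v] would be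
   both head and tail of [e]. *)
rewrite !inE => /orP[] /eqP Df /orP[] /eqP De;
  rewrite {}De {}Df in te' hf' we' wf' nef' *.
- by rewrite eqxx in nef'.
- have vw := common_vertex_inj nef ve vf wf' we'.
  by rewrite -vw in hf'; case: (head_tail v e).
- by rewrite (common_vertex_inj nef ve vf we' wf').
- by rewrite eqxx in nef'.
Qed.

End Switching.

(** * Comparison of balanced deletions with orientations *)

Section Frustration.
Variables (G : simple_graph) (O0 : orientation G).
Notation A := (antisym_line_graph O0).

(** Deleting the negative edges for [O] leaves a graph for which the reversal sign is a
    potential. *)
Lemma frustration_le_negative (O : orientation G) :
  frustration_index A <= #|negative_edges O|.
Proof.
have switchO := switched_reversal O O0.
set s := reversal_sign O O0 in switchO.
have s2 : forall e, (s e * s e = 1)%R by apply: reversal_sign_sqr.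
apply: (@bigminn_le_cond _ _ (fun F : {set {set A}} => #|F|)); apply/andP; split.
  apply/subsetP=> _ /imsetP[[e f] + ->]; rewrite inE /= => /eqP ef.
  apply/imsetP; exists (e, f) => //; rewrite inE /=; apply/eqP=> /= ef0.
  by rewrite (line_adj_switched e f switchO) ef0 mulr0 in ef.
apply: (@potential_balanced (@delete_edges A (negative_edges O)) s).
split=> // e f; rewrite /srel /= /delete_adj /=.
case: ifP => // /negbT/negative_edgesP not_neg.
have -> : line_adj O0 e f = (s e * s f * line_adj O e f)%R.
  by rewrite (line_adj_switched e f switchO) mulrA mulrACA !s2 !mul1r.
have := line_adj_vals O e f; rewrite !inE => /or3P[] /eqP adj_ef.
- by rewrite adj_ef mulr0 eqxx.
- by rewrite adj_ef mulr1.
- by case: not_neg.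
Qed.

(** A potential of the remaining graph gives a reorientation of [O0] whose line graph is positive
    outside [F]. *)
Lemma negative_le_deletion (F : {set {set A}}) : balanced (delete_edges F) ->
  exists O : orientation G, #|negative_edges O| <= #|F|.
Proof.
case/balanced_potential=> s [s2 sE]; have [O switchO] := reorientation O0 s2.
exists O; apply/subset_leq_card/subsetP=> _ /imsetP[[e f] + ->].
rewrite inE /= => /eqP ef; apply/negPn/negP=> /negPf efF.
have := sE e f; rewrite /srel /= /delete_adj efF /= => adj_ef.
move: ef; rewrite (line_adj_switched e f switchO).
have [->|/adj_ef->] := eqVneq (line_adj O0 e f) 0%R; first by rewrite mulr0.
by rewrite mulrACA !s2.
Qed.

End Frustration.

(* O0 is the reference orientation defining the oriented incidence matrix; it
   also provides the initial value of the minimum over all orientations O. *)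
Theorem lemma2 (G : simple_graph) (O0 : orientation G) :
  frustration_index (antisym_line_graph O0) =
    \big[minn / (\sum_(v : G) outdeg O0 v * indeg O0 v)]_(O : orientation G)
       (\sum_(v : G) outdeg O v * indeg O v).
Proof.
apply/eqP; rewrite eqn_leq; apply/andP; split.
  (* The initial value is the degree sum of [O0], so it obeys the same bound. *)
  by apply: leq_bigminn => [|O _];
    rewrite -card_negative_edges frustration_le_negative.
(* Stated for all balanced deletions, this also bounds the initial value of the frustration index,
   the size of the deletion of all edges. *)
have min_le (F : {set {set antisym_line_graph O0}}) : balanced (delete_edges F) ->
    \big[minn / (\sum_(v : G) outdeg O0 v * indeg O0 v)]_(O : orientation G)
       (\sum_(v : G) outdeg O v * indeg O v) <= #|F|.
  case/negative_le_deletion=> O; apply: leq_trans.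
  by rewrite card_negative_edges; apply: bigminn_le_cond.
by apply: leq_bigminn => [|F /andP[_]]; apply: min_le; apply: balanced_delete_all.
Qed.
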